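(* Let $C$ be a projective $[n,k]_q$ code and let $\mathcal{P}$ be the corresponding set of points in $PG(\mathbb{F}_q^k)$. Let $D$ be an $l$-dimensional subcode of $C$ (with $1\le l\le k$) and let $W_D$ be the associated subspace of $PG(\mathbb{F}_q^k)$ of co-dimension $l$. Then $\operatorname{supp}(D)$ is minimal (i.e. $D$ is a support-minimal subcode) if and only if $\langle \mathcal{P}\cap W_D\rangle=W_D$; equivalently, $\dim(\langle \mathcal{P}\cap W_D\rangle)=k-l$.
   Context: $\mathbb{F}_q$ is the finite field with $q$ elements. An $[n,k]_q$ linear code $C$ is a $k$-dimensional subspace of $\mathbb{F}_q^n$; all codes are assumed to have $k\ge1$ and effective length $n$, i.e. every coordinate position is non-zero in some codeword. Fix a generator matrix $G$ ($k\times n$, rows a basis of $C$) with columns $G_1,\dots,G_n$ (all non-zero). $C$ is called projective if the points $\langle G_1\rangle,\dots,\langle G_n\rangle$ of $PG(\mathbb{F}_q^k)$ (1-dimensional subspaces of $\mathbb{F}_q^k$) are pairwise distinct, and then $\mathcal{P}=\{\langle G_1\rangle,\dots,\langle G_n\rangle\}$ is the corresponding point set. All dimensions and co-dimensions are those of vector subspaces of $\mathbb{F}_q^k$. For a subcode (linear subspace) $D\le C$, its support is $\operatorname{supp}(D)=\{i\in\{1,\dots,n\} : \exists\, v\in D \text{ with } v_i\neq 0\}$. An $l$-dimensional subcode $D$ is called support-minimal if there is no other $l$-dimensional subcode $D'\le C$ such that $\operatorname{supp}(D')\subset\operatorname{supp}(D)$ (proper inclusion). For an $l$-dimensional subcode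 $D$ there is an $l\times k$ matrix $M$ such that the rows of $MG$ form a basis of $D$; the associated subspace is the nullspace $W_D=\{x\in\mathbb{F}_q^k : Mx=0\}$, which has co-dimension $l$ and depends only on $D$ (and $G$). $\mathcal{P}\cap W_D$ is the set of points of $\mathcal{P}$ contained in $W_D$, and $\langle\cdot\rangle$ denotes linear span (the span of the empty set being $\{0\}$). *)

(* Defs.v *)
From HB Require Import structures.
From mathcomp Require Import all_boot all_order all_algebra.

Set Implicit Arguments.
Unset Strict Implicit.
Unset Printing Implicit Defensive.

Import GRing.Theory.
Local Open Scope ring_scope.

Definition rows_of (F : finFieldType) (m n : nat) (A : 'M[F]_(m, n)) :
  seq 'rV[F]_n := [seq row i A | i : 'I_m].

Definition effective_length (F : finFieldType) (n : nat)
    (C : {vspace 'rV[F]_n}) : Prop :=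
  forall i : 'I_n, exists2 v : 'rV[F]_n, v \in C & v 0 i != 0.

Definition linear_code (F : finFieldType) (n k : nat)
    (C : {vspace 'rV[F]_n}) : Prop :=
  [/\ (0 < k)%N, \dim C = k & effective_length C].

Definition generator_matrix (F : finFieldType) (n k : nat)
    (C : {vspace 'rV[F]_n}) (G : 'M[F]_(k, n)) : Prop :=
  basis_of C (rows_of G).

Definition column_point (F : finFieldType) (n k : nat) (G : 'M[F]_(k, n))
    (i : 'I_n) : {vspace 'cV[F]_k} := <[col i G]>%VS.

Definition projective (F : finFieldType) (n k : nat) (G : 'M[F]_(k, n)) :
  Prop := injective (column_point G).

Definition point_set (F : finFieldType) (n k : nat) (G : 'M[F]_(k, n)) :
  seq {vspace 'cV[F]_k} := [seq column_point G i | i : 'I_n].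

(* The sum over an empty range is the zero subspace. *)
Definition span_points_in (F : finFieldType) (k : nat)
    (P : seq {vspace 'cV[F]_k}) (W : {vspace 'cV[F]_k}) : {vspace 'cV[F]_k} :=
  (\sum_(p <- P | (p <= W)%VS) p)%VS.

Definition supp (F : finFieldType) (n : nat) (D : {vspace 'rV[F]_n}) :
  {set 'I_n} := [set i | [exists v : 'rV[F]_n, (v \in D) && (v 0 i != 0)]].

Definition support_minimal (F : finFieldType) (n : nat)
    (C D : {vspace 'rV[F]_n}) : Prop :=
  ~ exists D' : {vspace 'rV[F]_n},
      [/\ (D' <= C)%VS, \dim D' = \dim D & supp D' \proper supp D].

Definition nullspace (F : finFieldType) (l k : nat) (M : 'M[F]_(l, k)) :
  {vspace 'cV[F]_k} := lker (linfun (mulmx M : 'cV[F]_k -> 'cV[F]_l)).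

Lemma mem_nullspace (F : finFieldType) (l k : nat) (M : 'M[F]_(l, k))
    (x : 'cV[F]_k) : (x \in nullspace M) = (M *m x == 0).
Proof. by rewrite memv_ker lfunE. Qed.

(* A relation rather than a function of D, since M is not unique: by
   associated_subspace_exists and associated_subspace_unique there is exactly
   one W for each subcode D of the code generated by G. *)
Definition associated_subspace (F : finFieldType) (n k : nat)
    (G : 'M[F]_(k, n)) (D : {vspace 'rV[F]_n}) (W : {vspace 'cV[F]_k}) : Prop :=
  exists2 M : 'M[F]_(\dim D, k),
    basis_of D (rows_of (M *m G)) & W = nullspace M.

Lemma mem_rows_span (F : finFieldType) (m n : nat) (A : 'M[F]_(m, n))
    (v : 'rV[F]_n) :
  (v \in <<rows_of A>>%VS) <-> exists u : 'rV[F]_m, v = u *m A.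
Proof.
have sz : size (rows_of A) == m by rewrite size_map -cardE card_ord.
have nthE (i : 'I_m) : (rows_of A)`_i = row i A.
  by rewrite (nth_map i) ?size_enum_ord // nth_ord_enum.
split=> [vA | [u ->]].
  have vA' : v \in <<Tuple sz>>%VS by [].
  exists (\row_i coord (Tuple sz) i v); rewrite mulmx_sum_row {1}(coord_span vA').
  by apply: eq_bigr => i _; rewrite mxE nthE.
rewrite mulmx_sum_row; apply: memv_suml => i _; apply/memvZ/memv_span.
by apply/imageP; exists i.
Qed.

Lemma associated_subspace_exists (F : finFieldType) (n k : nat)
    (C D : {vspace 'rV[F]_n}) (G : 'M[F]_(k, n)) :
  generator_matrix C G -> (D <= C)%VS ->
  exists W : {vspace 'cV[F]_k}, associated_subspace G D W.
Proof.
case/andP=> /eqP CG _ sDC.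
have cf (i : 'I_(\dim D)) : exists u : 'rV[F]_k, (vbasis D)`_i == u *m G.
  have : (vbasis D)`_i \in <<rows_of G>>%VS.
    rewrite CG; apply: (subvP sDC); apply: vbasis_mem.
    by rewrite mem_nth ?size_tuple.
  by case/mem_rows_span=> u ->; exists u.
pose M : 'M[F]_(\dim D, k) := \matrix_i xchoose (cf i).
exists (nullspace M); exists M => //.
suff -> : rows_of (M *m G) = vbasis D by exact: vbasisP.
apply: (@eq_from_nth _ 0) => [|i].
  by rewrite size_map -cardE card_ord size_tuple.
rewrite size_map -cardE card_ord => lt_i.
rewrite (nth_map (Ordinal lt_i)) ?size_enum_ord //.
have -> : nth (Ordinal lt_i) (enum 'I_(\dim D)) i = Ordinal lt_i.
  exact: (nth_ord_enum (Ordinal lt_i) (Ordinal lt_i)).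
by rewrite row_mul rowK -(eqP (xchooseP (cf (Ordinal lt_i)))).
Qed.

Lemma associated_subspace_unique (F : finFieldType) (n k : nat)
    (C D : {vspace 'rV[F]_n}) (G : 'M[F]_(k, n)) (W W' : {vspace 'cV[F]_k}) :
  generator_matrix C G ->
  associated_subspace G D W -> associated_subspace G D W' -> W = W'.
Proof.
case/andP=> _ freeG.
have injG (u v : 'rV[F]_k) : u *m G = v *m G -> u = v.
  have sz : size (rows_of G) == k by rewrite size_map -cardE card_ord.
  have nthE (i : 'I_k) : (rows_of G)`_i = row i G.
    by rewrite (nth_map i) ?size_enum_ord // nth_ord_enum.
  have fG : free (Tuple sz) by [].
  move=> uv; have /eqP := uv; rewrite -subr_eq0 -mulmxBl => /eqP.
  rewrite mulmx_sum_row => s0; apply/rowP=> i; apply/eqP.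
  rewrite -subr_eq0; apply/eqP.
  have /freeP/(_ (fun j => (u - v) 0 j)) := fG.
  move=> /(_ _ i); rewrite !mxE; apply; rewrite -[RHS]s0.
  by apply: eq_bigr => j _; rewrite /= nthE.
have sub (V V' : {vspace 'cV[F]_k}) : associated_subspace G D V ->
    associated_subspace G D V' -> (V <= V')%VS.
  case=> M /andP[/eqP sM _] -> [M' /andP[/eqP sM' _] ->].
  apply/subvP=> x; rewrite !mem_nullspace => /eqP Mx0; apply/eqP/row_matrixP=> i.
  have : row i (M' *m G) \in <<rows_of (M *m G)>>%VS.
    have : row i (M' *m G) \in <<rows_of (M' *m G)>>%VS.
      by apply/memv_span/imageP; exists i.
    by move: (row i _) => w; rewrite sM sM'.
  case/mem_rows_span=> u; rewrite row_mul mulmxA => /injG e.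
  by rewrite row_mul e -mulmxA Mx0 mulmx0 row0.
by move=> hW hW'; apply/eqP; rewrite eqEsubv !sub.
Qed.

(* Main.v *)
(* Let S be the complement of supp D, so that S indexes the columns of G lying
   in W.  The codewords vanishing on S form a subcode Z of dimension k - dim U,
   where U is the span of these columns, and Z contains exactly the subcodes of
   C whose support lies in supp D; in particular D <= Z.  If U = W then D = Z,
   and D is the only subcode of its dimension with support inside supp D.  If U
   is smaller than W then dim Z > l, so asking in addition that one coordinate
   in supp D vanishes still leaves room for an l-dimensional subcode. *)
Require Import Defs.
From HB Require Import structures.
From mathcomp Require Import all_boot all_order all_algebra.

Set Implicit Arguments.
Unset Strict Implicit.
Unset Printing Implicit Defensive.

Import GRing.Theory.
Local Open Scope ring_scope.

Lemma size_rows_of (F : finFieldType) (m n : nat) (A : 'M[F]_(m, n)) :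
  size (rows_of A) = m.
Proof. by rewrite size_map -cardE card_ord. Qed.

Lemma nth_rows_of (F : finFieldType) (m n : nat) (A : 'M[F]_(m, n))
    (i : 'I_m) : (rows_of A)`_i = row i A.
Proof. by rewrite (nth_map i) ?size_enum_ord // nth_ord_enum. Qed.

Lemma free_rows_of (F : finFieldType) (m n : nat) (A : 'M[F]_(m, n)) :
  free (rows_of A) = row_free A.
Proof.
have sz : size (rows_of A) == m by rewrite size_rows_of.
have sumE (u : 'I_m -> F) :
    \sum_i u i *: (Tuple sz)`_i = (\row_i u i) *m A.
  by rewrite mulmx_sum_row; apply: eq_bigr => i _; rewrite mxE nth_rows_of.
apply/(@freeP _ _ _ (Tuple sz))/idP => [fA | fA u].
  apply/inj_row_free => v vA; apply/rowP=> i; rewrite mxE; apply: fA.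
  by rewrite sumE -[RHS]vA; congr (_ *m _); apply/rowP=> j; rewrite mxE.
rewrite sumE => /eqP; rewrite mulmx_free_eq0 // => /eqP/rowP u0 i.
by have := u0 i; rewrite !mxE.
Qed.

(** Passing to [row_base A] keeps the row space and makes the rows free, so their number is the
    dimension. *)
Lemma dim_span_rows (F : finFieldType) (m n : nat) (A : 'M[F]_(m, n)) :
  \dim <<rows_of A>> = \rank A.
Proof.
have -> : <<rows_of A>>%VS = <<rows_of (row_base A)>>%VS.
  apply/eqP; rewrite eqEsubv; apply/andP; split; apply/subvP=> v;
    move/mem_rows_span=> [u ->]; apply/mem_rows_span; apply/submxP.
    by rewrite eq_row_base submxMl.
  by rewrite (submx_trans (submxMl _ _)) ?eq_row_base.
have := row_base_free A; rewrite -free_rows_of /free size_rows_of.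
by move/eqP.
Qed.

(** Bridges the column vectors of the points and the row spaces through which matrix ranks are
    computed. *)
Lemma dim_trmx_img (F : finFieldType) (k : nat) (U : {vspace 'rV[F]_k}) :
  \dim (linfun (trmx : 'rV[F]_k -> 'cV[F]_k) @: U) = \dim U.
Proof.
apply: limg_dim_eq; apply/eqP; rewrite -subv0; apply/subvP=> v.
rewrite memv_cap memv_ker lfunE memv0 => /andP[_] /=.
by rewrite -[v]trmxK trmx_eq0 trmxK.
Qed.

(** Transposition identifies the nullspace with the row space of [kermx M^T]. *)
Lemma dim_nullspace (F : finFieldType) (l k : nat) (M : 'M[F]_(l, k)) :
  \dim (nullspace M) = (k - \rank M)%N.
Proof.
rewrite -mxrank_tr -mxrank_ker -dim_span_rows -dim_trmx_img.
congr (\dim _); apply/vspaceP=> x; rewrite mem_nullspace.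
apply/eqP/memv_imgP => [Mx0 | [v /mem_rows_span[u ->] ->]].
  exists x^T; last by rewrite lfunE /= trmxK.
  apply/mem_rows_span/submxP/sub_kermxP.
  by rewrite -trmx_mul Mx0 trmx0.
by rewrite lfunE /= -[M in M *m _]trmxK -trmx_mul -mulmxA mulmx_ker mulmx0 trmx0.
Qed.

(** Columns outside [S] are zeroed rather than deleted: the rank is the same and the indices stay in
    ['I_n]. *)
Definition mask_cols (F : finFieldType) (n k : nat) (G : 'M[F]_(k, n))
    (S : {set 'I_n}) : 'M[F]_(k, n) :=
  \matrix_(i, j) (G i j *+ (j \in S)).

Lemma dim_span_cols (F : finFieldType) (n k : nat) (G : 'M[F]_(k, n))
    (S : {set 'I_n}) :
  \dim (\sum_(i in S) <[col i G]>) = \rank (mask_cols G S).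
Proof.
rewrite -mxrank_tr -dim_span_rows -dim_trmx_img limg_span span_def.
rewrite big_map /rows_of big_image /= big_mkcond; congr (\dim _).
apply: eq_bigr => i _; rewrite lfunE /=.
have -> : (row i (mask_cols G S)^T)^T = col i G *+ (i \in S).
  by apply/colP=> j; rewrite !mxE mulmxnE mxE.
by case: (i \in S) => //; rewrite mulr0n; apply/eqP; rewrite eq_sym -subv0 -memvE.
Qed.

(** The word [u *m G] vanishes on [S] exactly when [u] lies in the left kernel of
    [mask_cols G S]. *)
Definition vanishing_subcode (F : finFieldType) (n k : nat)
    (G : 'M[F]_(k, n)) (S : {set 'I_n}) : {vspace 'rV[F]_n} :=
  <<rows_of (kermx (mask_cols G S) *m G)>>%VS.

Lemma mem_vanishing_subcode (F : finFieldType) (n k : nat)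
    (G : 'M[F]_(k, n)) (S : {set 'I_n}) (v : 'rV[F]_n) :
  v \in vanishing_subcode G S <->
  v \in <<rows_of G>>%VS /\ {in S, forall i, v 0 i = 0}.
Proof.
have maskE (u : 'rV[F]_k) i :
    (u *m mask_cols G S) 0 i = (u *m G) 0 i *+ (i \in S).
  rewrite !mxE -sumrMnl; apply: eq_bigr => j _.
  by rewrite !mxE mulrnAr.
split=> [/mem_rows_span[u ->]|[/mem_rows_span[u ->] u0]].
  rewrite mulmxA; split=> [|i iS]; first by apply/mem_rows_span; eexists.
  have := maskE (u *m kermx (mask_cols G S)) i.
  by rewrite -(mulmxA u) mulmx_ker mulmx0 iS mulr1n mxE => <-.
have /submxP[w ->] : (u <= kermx (mask_cols G S))%MS.
  apply/sub_kermxP/rowP=> i; rewrite maskE [RHS]mxE.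
  by case: (boolP (i \in S)) => // /u0 ->.
by apply/mem_rows_span; exists w; rewrite -mulmxA.
Qed.

(** Multiplication by the row-free [G] is injective on row vectors, so the dimension is that of the
    left kernel of [mask_cols G S]. *)
Lemma dim_vanishing_subcode (F : finFieldType) (n k : nat)
    (G : 'M[F]_(k, n)) (S : {set 'I_n}) : row_free G ->
  \dim (vanishing_subcode G S) = (k - \dim (\sum_(i in S) <[col i G]>))%N.
Proof.
by move=> fG; rewrite dim_span_rows mxrankMfree // mxrank_ker dim_span_cols.
Qed.

Lemma subspace_of_dim (F : fieldType) (vT : vectType F) (V : {vspace vT})
    (l : nat) :
  (l <= \dim V)%N -> exists2 U : {vspace vT}, (U <= V)%VS & \dim U = l.
Proof.
move=> lV; exists <<take l (vbasis V)>>%VS.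
  apply/span_subvP=> v /mem_take; exact: vbasis_mem.
have : free (take l (vbasis V)).
  have := basis_free (vbasisP V); rewrite -{1}(cat_take_drop l (vbasis V)).
  exact: catl_free.
rewrite /free => /eqP ->; rewrite size_take size_tuple.
by case: ltngtP lV.
Qed.

(** Rank-nullity for a coordinate functional, whose image has dimension at most one. *)
Lemma dim_coord_hyperplane (F : fieldType) (n : nat) (V : {vspace 'rV[F]_n})
    (j : 'I_n) :
  (\dim V <= (\dim (V :&: lker (linfun (col j : 'rV[F]_n -> 'M[F]_1)))).+1)%N.
Proof.
set f := linfun _; rewrite -(limg_ker_dim f V) -[leqRHS]addn1 leq_add2l.
by rewrite (leq_trans (dimvS (subvf _))) // dimvf.
Qed.

Lemma supp_vanish (F : finFieldType) (n : nat) (D : {vspace 'rV[F]_n})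
    (i : 'I_n) :
  reflect {in D, forall v : 'rV[F]_n, v 0 i = 0} (i \notin supp D).
Proof.
rewrite inE negb_exists; apply: (iffP forallP) => [h v vD | h v].
  by have := h v; rewrite vD /= negbK => /eqP.
by rewrite negb_and negbK; case: (boolP (v \in D)) => //= /h ->.
Qed.

Lemma col_mul (R : pzSemiRingType) (m n p : nat) (j : 'I_p) (A : 'M[R]_(m, n))
    (B : 'M[R]_(n, p)) : col j (A *m B) = A *m col j B.
Proof. by apply/colP=> i; rewrite !mxE; apply: eq_bigr => h _; rewrite mxE. Qed.

(** [M *m col i G] is column [i] of [M *m G]; it is zero iff all generators of the subcode, hence
    all its words, vanish at [i]. *)
Lemma col_in_nullspace (F : finFieldType) (l n k : nat) (M : 'M[F]_(l, k))
    (G : 'M[F]_(k, n)) (i : 'I_n) :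
  (col i G \in nullspace M) = (i \notin supp <<rows_of (M *m G)>>).
Proof.
rewrite mem_nullspace -col_mul; apply/eqP/supp_vanish => [c0 v|h].
  case/mem_rows_span=> u ->.
  have <- : (col i (u *m (M *m G))) 0 0 = (u *m (M *m G)) 0 i.
    by rewrite mxE.
  by rewrite col_mul c0 mulmx0 mxE.
apply/colP=> j; rewrite !mxE -[RHS](h (row j (M *m G))) ?mxE //.
by apply/memv_span/imageP; exists j.
Qed.

Theorem lemma4p1 (F : finFieldType) (n k l : nat) (C : {vspace 'rV[F]_n})
    (G : 'M[F]_(k, n)) (D : {vspace 'rV[F]_n}) (W : {vspace 'cV[F]_k})
    (hC : linear_code k C) (hG : generator_matrix C G) (hproj : projective G)
    (hl : (1 <= l <= k)%N) (hDC : (D <= C)%VS) (hDl : \dim D = l)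
    (hW : associated_subspace G D W) :
  (support_minimal C D <-> span_points_in (point_set G) W = W) /\
  (span_points_in (point_set G) W = W <->
     \dim (span_points_in (point_set G) W) = (k - l)%N).
Proof.
case: hW => M /andP[/eqP sM _] WE; case/andP: hG => /eqP CE.
rewrite free_rows_of => fG; case/andP: hl => l1 lk.
have rM : \rank M = l by rewrite -(mxrankMfree M fG) -dim_span_rows sM.
have dW : \dim W = (k - l)%N by rewrite WE dim_nullspace rM.
set S := ~: supp D; set U := span_points_in _ _.
have UE : U = (\sum_(i in S) <[col i G]>)%VS.
  rewrite /U /span_points_in /point_set big_image_cond /=.
  apply: eq_bigl => i; rewrite -memvE WE col_in_nullspace sM.
  by rewrite in_setC.
have sUW : (U <= W)%VS.
  rewrite UE; apply/subv_sumP => i.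
  by rewrite in_setC -sM WE -memvE col_in_nullspace.
pose Z := vanishing_subcode G S.
have ZE v : v \in Z <-> v \in C /\ {in S, forall i, v 0 i = 0}.
  by rewrite -CE; apply: mem_vanishing_subcode.
have dZ : \dim Z = (k - \dim U)%N by rewrite UE dim_vanishing_subcode.
have sub_Z (D' : {vspace 'rV[F]_n}) :
    (D' <= C)%VS -> supp D' \subset supp D -> (D' <= Z)%VS.
  move=> D'C sD'; apply/subvP=> v vD'; apply/ZE; split; first exact: subvP vD'.
  move=> i; rewrite inE => iD; apply: (supp_vanish _ _ _) vD'.
  by apply: contra iD; apply: subsetP.
have dU : (\dim U <= k - l)%N by rewrite -dW dimvS.
have eqUW : U = W <-> \dim U = (k - l)%N.
  split=> [-> // | e]; apply/eqP.
  by rewrite eqEdim sUW dW e leqnn.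
split=> //; split=> [minD | /eqUW e [D' [D'C dD' /properP[sD' [j jD /negP[]]]]]].
- apply/eqUW/eqP; rewrite eqn_leq dU leqNgt; apply/negP=> ltU; apply: minD.
  (* Since [1 <= l], the subcode [D] is nonzero and has a coordinate [j] that can be removed. *)
  have [j jD] : exists j, j \in supp D.
    apply/set0Pn/eqP => s0; move: l1; rewrite -hDl lt0n dimv_eq0 => /negP[].
    rewrite -subv0; apply/subvP=> v vD; rewrite memv0; apply/eqP/rowP=> i.
    rewrite mxE; apply: (supp_vanish _ _ _) vD; by rewrite s0 inE.
  (* Here [\dim Z] is at least [l + 1], so [Z :&: H] still has dimension at least [l]; words in it
     vanish on [S] and at [j]. *)
  pose H := lker (linfun (col j : 'rV[F]_n -> 'M[F]_1)).
  have [|D' sD' dD'] := @subspace_of_dim _ _ (Z :&: H)%VS l.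
    rewrite -ltnS (leq_trans _ (dim_coord_hyperplane Z j)) // dZ.
    by rewrite ltn_subRL addnC -ltn_subRL.
  have D'0 v :
      v \in D' -> [/\ v \in C, {in S, forall i, v 0 i = 0} & v 0 j = 0].
    move/(subvP sD'); rewrite memv_cap memv_ker lfunE /=.
    by case/andP=> /ZE[vC v0] /eqP/colP/(_ 0); rewrite !mxE.
  exists D'; split; [by apply/subvP=> v /D'0[] | by rewrite dD' |].
  apply/properP; split; last first.
    by exists j => //; apply/supp_vanish => v /D'0[].
  apply/subsetP=> i; apply: contraLR => iD; apply/supp_vanish=> v /D'0[_ v0 _].
  by apply: v0; rewrite inE.
(* The truncated difference [k - (k - l)] equals [l] because [l <= k]. *)
- have dZl : \dim Z = l by rewrite dZ e subKn.
  have DZ : D = Z by apply/eqP; rewrite eqEdim sub_Z //= dZl hDl.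
  (* Both subcodes fill [Z], so [D'] cannot miss the coordinate [j] of [supp D]. *)
  suff -> : D' = D by [].
  by apply/eqP; rewrite eqEdim dD' leqnn andbT DZ; apply: sub_Z.
Qed.
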